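(* Let $P$ be a finite bounded graded poset of rank $n$. Then the following are equivalent: (1) $P$ has an $S_n$ EL-labelling; (2) $P$ is left modular; (3) $P$ is supersolvable.
   Context: A poset is bounded if it has a unique minimum $\hat 0$ and maximum $\hat 1$; graded of rank $n$ if all maximal chains have length $n$. An edge-labelling $\gamma$ (a map from covering relations to $\mathbb Z$) is an EL-labelling if for all $y<z$ there is a unique unrefinable chain from $y$ to $z$ with weakly increasing labels, and its label sequence lexicographically precedes those of all other unrefinable chains from $y$ to $z$. An $S_n$ EL-labelling is an EL-labelling such that along every maximal chain $\hat0=w_0\lessdot\cdots\lessdot w_n=\hat1$, the map $i\mapsto\gamma(w_{i-1},w_i)$ is a permutation of $[n]$. $x\vee y$, $x\wedge y$ denote least common upper bound / greatest common lower bound when they exist. For $w,z\ge y$, $w\wedge_y z$ is the greatest element of $\{u: y\le u\le w,\ u\le z\}$ if it exists; for $w,y\le z$, $w\vee^z y$ is the least element of $\{u: w,y\le u\le z\}$ if it exists. An element $x$ is viable if for all $y\le z$ both $(x\vee y)\wedge_y z$ and $(x\wedge z)\vee^z y$ exist; a viable $x$ is left modular if $(x\vee y)\wedge_y z=(x\wedge z)\vee^z y$ for all $y\le z$. A maximal chain is viable (resp. left modular) if all its elements are viable (resp. viable and left modular); $P$ is left modular if it has a left modular maximal chain. Given a viable maximal chain $M$ and any chain $c$ of $P$, $R_M(c)$ is the smallest subposet of $P$ containing $M$ and $c$ and such that whenever $y\le z$ are in $R_M(c)$, then $(x\vee y)\wedge_y z$ and $(x\wedge z)\vee^z y$ lie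 in $R_M(c)$ for all $x\in M$. $P$ is supersolvable (with M-chain $M$) if $M$ is a viable maximal chain and $R_M(c)$ is a distributive lattice for every chain $c$ of $P$. *)

(* Defs.v *)
From mathcomp Require Import all_boot all_order all_algebra.

Set Implicit Arguments.
Unset Strict Implicit.
Unset Printing Implicit Defensive.

Import Order.TTheory.
Local Open Scope order_scope.

Section Chains.
Context {d : Order.disp_t} {P : finPOrderType d}.

Definition covers (x y : P) : bool :=
  (x < y) && ~~ [exists u, x < u < y].

Definition chain (c : {set P}) : bool :=
  [forall x in c, forall y in c, x >=< y].

Definition maximal_chain (M : {set P}) : bool := maxset chain M.

Definition graded (n : nat) : Prop :=
  forall M : {set P}, maximal_chain M -> #|M| = n.+1.

(* [y :: s] lists the elements y = w_0, w_1, ..., w_r = z, so r = size s. *)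
Definition unrefinable (y z : P) (s : seq P) : bool :=
  path covers y s && (last y s == z).

End Chains.
Arguments graded {d} P n.

Section Labellings.
Context {d : Order.disp_t} {P : finPOrderType d}.

(* Only the values of [g] on pairs (x, y) with [covers x y] are ever used. *)
Implicit Type g : P -> P -> int.

Definition labels g (w : seq P) : seq int :=
  if w is y :: s then pairmap g y s else [::].

Definition EL_labelling g : Prop :=
  forall y z : P, y < z ->
  exists s : seq P,
    [/\ unrefinable y z s,
        sorted <=%O (labels g (y :: s)),
        forall t, unrefinable y z t -> sorted <=%O (labels g (y :: t)) -> t = s
      & forall t, unrefinable y z t -> t != s ->
          (labels g (y :: s) : seqlexi int) < labels g (y :: t)].

Definition Sn_EL_labelling (n : nat) g : Prop :=
  EL_labelling g /\
  (* w is a maximal chain listed in increasing order *)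
  forall w : seq P, sorted <%O w -> maximal_chain [set x in w] ->
    perm_eq (labels g w) [seq Posz i | i <- iota 1 n].

End Labellings.

Section PartialLattice.
Context {d : Order.disp_t} {P : finPOrderType d}.
Implicit Types (A M R c : {set P}) (w x y z : P).

Definition least A : option P := [pick u in A | [forall v in A, u <= v]].
Definition greatest A : option P := [pick u in A | [forall v in A, v <= u]].

(* Least upper bound and greatest lower bound in the subposet A, where they
   exist. *)
Definition join_in A x y : option P := least [set u in A | x <= u & y <= u].
Definition meet_in A x y : option P := greatest [set u in A | u <= x & u <= y].

(* w /\_y z for w, z >= y, and w \/^z y for w, y <= z. *)
Definition meet_above y w z : option P := meet_in [set u | y <= u] w z.
Definition join_below z w y : option P := join_in [set u | u <= z] w y.

(* (x \/ y) /\_y z and (x /\ z) \/^z y, for y <= z. *)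
Definition join_meet x y z : option P :=
  obind (fun j => meet_above y j z) (join_in setT x y).
Definition meet_join x y z : option P :=
  obind (fun m => join_below z m y) (meet_in setT x z).

Definition viable x : Prop :=
  forall y z, y <= z -> join_meet x y z /\ meet_join x y z.

Definition left_modular_elt x : Prop :=
  viable x /\ forall y z, y <= z -> join_meet x y z = meet_join x y z.

(* An undefined join_meet or meet_join imposes no condition; this never happens
   when every element of M is viable. *)
Definition R_closed M c R : bool :=
  [&& M \subset R, c \subset R
    & [forall x in M, forall y in R, forall z in R, (y <= z) ==>
        oapp (mem R) true (join_meet x y z)
        && oapp (mem R) true (meet_join x y z)]].

Definition R_gen M c : {set P} := \bigcap_(R : {set P} | R_closed M c R) R.

(* The order on R is the one induced from P; meets and joins are those of R. *)
Definition distributive_lattice R : Prop :=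
  {in R &, forall x y, meet_in R x y /\ join_in R x y} /\
  {in R & &, forall x y z j a b,
     join_in R y z = Some j ->
     meet_in R x y = Some a -> meet_in R x z = Some b ->
     meet_in R x j = join_in R a b}.

End PartialLattice.

Section Properties.
Context {d : Order.disp_t} (P : finPOrderType d).

Definition has_Sn_EL_labelling (n : nat) : Prop :=
  exists g : P -> P -> int, Sn_EL_labelling n g.

Definition left_modular : Prop :=
  exists2 M : {set P}, maximal_chain M & {in M, forall x, left_modular_elt x}.

Definition supersolvable : Prop :=
  exists M : {set P},
    [/\ maximal_chain M, {in M, forall x, viable x}
      & forall c : {set P}, chain c -> distributive_lattice (R_gen M c)].

End Properties.

(* Main.v *)
Require Import Defs.
From mathcomp Require Import all_boot all_order all_algebra.

Set Implicit Arguments.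
Unset Strict Implicit.
Unset Printing Implicit Defensive.

Import Order.TTheory.
Local Open Scope order_scope.

(* For an element x and y <= z, say that y is x-low under z if z lies below
   every common upper bound of x and y, and x-high if every common lower
   bound of x and z lies below y. Then x is left modular exactly when every
   pair y <= z factors uniquely as y <= u <= z with (y, u) low and (u, z)
   high; the middle element is (x \/ y) /\_y z = (x /\ z) \/^z y.

   Given an S_n EL-labelling, let M be the increasing chain. Since the
   labels on an interval do not depend on the chain, "all labels <= i" and
   "all labels > i" are such a low/high factorization system for x_i, the
   middle element of [y, z] being the point of the increasing chain at which
   the labels pass i.

   Given a left modular chain M = (x_i), let S z be the set of i for which
   x_(i-1) /\ z < x_i /\ z. This set grows strictly along covers, hence by
   exactly one element because P is graded, and (y, z) is x_i-low (resp.
   x_i-high) iff all elements of S z \ S y are <= i (resp. > i). Labelling y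
   <. z by the element of S z \ S y gives the S_n EL-labelling. Moreover,
   the elements obtained by iterating u |-> (x_i \/ u) /\_u c along a chain
   c, with i decreasing, form a set on which S is an order embedding with
   image closed under union and intersection; this set is R_M(c), which is
   therefore distributive.

   Conversely, if R_M(c) is distributive for c = {y, z}, then the modular
   identity for x, y, z is an instance of the distributive law. *)

(** * Left modularity as unique factorization *)

Section PartialOps.
Context {d : Order.disp_t} {P : finPOrderType d}.
Implicit Types (A R : {set P}) (x y z u : P).

Lemma least_Some A u :
  least A = Some u <-> u \in A /\ {in A, forall v, u <= v}.
Proof.
rewrite /least; case: pickP => [w /andP[wA /forall_inP wP]|noA]; split=> //.
- by case=> <-.
- case=> uA uP; congr Some; apply/le_anti.
  by rewrite (wP _ uA) (uP _ wA).
- by case=> uA uP; have := noA u; rewrite uA => /negP[]; apply/forall_inP.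
Qed.

Lemma greatest_Some A u :
  greatest A = Some u <-> u \in A /\ {in A, forall v, v <= u}.
Proof.
rewrite /greatest; case: pickP => [w /andP[wA /forall_inP wP]|noA]; split=> //.
- by case=> <-.
- case=> uA uP; congr Some; apply/le_anti.
  by rewrite (wP _ uA) (uP _ wA).
- by case=> uA uP; have := noA u; rewrite uA => /negP[]; apply/forall_inP.
Qed.

Lemma join_in_Some R x y u : join_in R x y = Some u <->
  [/\ u \in R, x <= u, y <= u & {in R, forall v, x <= v -> y <= v -> u <= v}].
Proof.
split=> [/least_Some[]|[uR xu yu uP]]; last apply/least_Some.
  rewrite inE => /and3P[uR xu yu] uP.
  by split=> // v vR xv yv; apply: uP; rewrite inE vR xv.
by rewrite inE uR xu yu; split=> // v; rewrite inE => /and3P[vR xv]; apply: uP.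
Qed.

Lemma meet_in_Some R x y u : meet_in R x y = Some u <->
  [/\ u \in R, u <= x, u <= y & {in R, forall v, v <= x -> v <= y -> v <= u}].
Proof.
split=> [/greatest_Some[]|[uR xu yu uP]]; last apply/greatest_Some.
  rewrite inE => /and3P[uR xu yu] uP.
  by split=> // v vR xv yv; apply: uP; rewrite inE vR xv.
by rewrite inE uR xu yu; split=> // v; rewrite inE => /and3P[vR xv]; apply: uP.
Qed.

Lemma join_meet_Some x y z u : join_meet x y z = Some u <->
  exists2 j, join_in setT x y = Some j
  & [/\ y <= u, u <= j, u <= z & forall v, y <= v -> v <= j -> v <= z ->
    v <= u].
Proof.
rewrite /join_meet; case: (join_in _ _ _) => [j|]; last by split=> // -[].
rewrite /= /meet_above; split=> [/meet_in_Some[]|[_ [<-] [yu uj uz uP]]].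
  by rewrite inE => yu uj uz uP; exists j => //; split=> // v yv; apply: uP;
    rewrite inE.
by apply/meet_in_Some; rewrite inE; split=> // v; rewrite inE; apply: uP.
Qed.

Lemma meet_join_Some x y z u : meet_join x y z = Some u <->
  exists2 m, meet_in setT x z = Some m
  & [/\ m <= u, y <= u, u <= z & forall v, m <= v -> y <= v -> v <= z ->
    u <= v].
Proof.
rewrite /meet_join; case: (meet_in _ _ _) => [m|]; last by split=> // -[].
rewrite /= /join_below; split=> [/join_in_Some[]|[_ [<-] [mu yu uz uP]]].
  by rewrite inE => uz mu yu uP; exists m => //; split=> // v mv yv vz;
    apply: uP; rewrite ?inE.
by apply/join_in_Some; rewrite inE; split=> // v; rewrite inE => ? ? ?;
  apply: uP.
Qed.

(* For [y <= z] these say [z <= x \/ y] and [x /\ z <= y] respectively, without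
   presupposing that the join or the meet exists. *)
Definition lo x y z := [forall u, (x <= u) && (y <= u) ==> (z <= u)].
Definition hi x y z := [forall u, (u <= x) && (u <= z) ==> (u <= y)].

Lemma loP x y z :
  reflect (forall u, x <= u -> y <= u -> z <= u) (lo x y z).
Proof.
apply: (iffP forallP) => h u; last by apply/implyP => /andP[]; apply: h.
by move=> xu yu; have := h u; rewrite xu yu.
Qed.

Lemma hiP x y z :
  reflect (forall u, u <= x -> u <= z -> u <= y) (hi x y z).
Proof.
apply: (iffP forallP) => h u; last by apply/implyP => /andP[]; apply: h.
by move=> xu yu; have := h u; rewrite xu yu.
Qed.

Lemma lo_refl x y : lo x y y. Proof. by apply/loP. Qed.
Lemma hi_refl x y : hi x y y. Proof. by apply/hiP. Qed.

Lemma lo_trans x u y z : lo x y u -> lo x u z -> lo x y z.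
Proof. by move=> /loP yu /loP uz; apply/loP => v xv yv; apply/uz/yu. Qed.

Lemma hi_trans x u y z : hi x y u -> hi x u z -> hi x y z.
Proof. by move=> /hiP yu /hiP uz; apply/hiP => v vx vz; apply/yu/uz. Qed.

Lemma lo_sub x y z y' z' : y <= y' -> z' <= z -> lo x y z -> lo x y' z'.
Proof.
move=> yy' z'z /loP h; apply/loP => u xu y'u; apply: (le_trans z'z).
by apply: h => //; apply: le_trans y'u.
Qed.

Lemma hi_sub x y z y' z' : y <= y' -> z' <= z -> hi x y z -> hi x y' z'.
Proof.
move=> yy' z'z /hiP h; apply/hiP => u ux uz'; apply: le_trans yy'.
by apply: h => //; apply: le_trans z'z.
Qed.

Lemma lo_le x x' y z : x <= x' -> lo x y z -> lo x' y z.
Proof. by move=> xx' /loP h; apply/loP => u x'u; apply: h; apply: le_trans x'u.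
Qed.

Lemma hi_le x x' y z : x' <= x -> hi x y z -> hi x' y z.
Proof. by move=> xx' /hiP h; apply/hiP => u ux'; apply: h; apply: le_trans xx'.
Qed.

Definition split_at x y z u := [&& y <= u, u <= z, lo x y u & hi x u z].

(** The common value [u] lies below [x \/ y], hence is low over [y], and above [x /\ z], hence is
    high under [z]. Any other split point is pinched between the maximality of [join_meet] and the
    minimality of [meet_join]. *)
Lemma left_modular_split x y z : left_modular_elt x -> y <= z ->
  exists2 u, join_meet x y z = Some u /\ meet_join x y z = Some u
  & split_at x y z u /\ (forall v, split_at x y z v -> v = u).
Proof.
move=> [vx lmx] yz; have [] := vx _ _ yz; have := lmx _ _ yz.
case Eu: (join_meet x y z) => [u|] // /esym Eu' _ _; exists u => //.
move/join_meet_Some: Eu => [j /join_in_Some[_ xj yj jP] [yu uj uz uP]].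
move/meet_join_Some: Eu' => [m /meet_in_Some[_ mx mz mP] [mu _ _ uP']].
split=> [|v /and4P[yv vz /loP lov /hiP hiv]].
  rewrite /split_at yu uz /=; apply/andP; split.
    by apply/loP => v xv yv; apply: le_trans uj _; apply: jP.
  by apply/hiP => v vx' vz; apply: le_trans _ mu; apply: mP.
by apply/le_anti; rewrite uP ?uP' ?(hiv _ mx mz) ?(lov _ xj yj).
Qed.

Lemma cover_between (y z u : P) :
  covers y z -> y <= u -> u <= z -> u = y \/ u = z.
Proof.
move=> /andP[_ /existsPn/(_ u)]; rewrite !le_eqVlt => h.
move=> /predU1P[->|yu]; first by left.
by move=> /predU1P[->|uz]; [right|rewrite yu uz in h].
Qed.

Lemma cover_lt (y z : P) : covers y z -> y < z.
Proof. by case/andP. Qed.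

End PartialOps.

(** * Unrefinable chains *)

Section Unrefinable.
Context {d : Order.disp_t} {P : finPOrderType d}.
Implicit Types (y z u v : P) (s t : seq P).

Lemma unrefinable_le y z s : unrefinable y z s -> y <= z.
Proof.
elim: s y => [|a s IH] y; first by rewrite /unrefinable /= => /eqP->.
rewrite /unrefinable /= -andbA => /andP[/cover_lt/ltW ya as_z].
by apply: le_trans ya _; apply: IH.
Qed.

Lemma unrefinable_nil y z : unrefinable y z [::] = (y == z).
Proof. by []. Qed.

Lemma unrefinable_cons y z u s :
  unrefinable y z (u :: s) = covers y u && unrefinable u z s.
Proof. by rewrite /unrefinable /= andbA. Qed.

Lemma unrefinable_cat y z s t :
  unrefinable y z (s ++ t) =
    unrefinable y (last y s) s && unrefinable (last y s) z t.
Proof. by rewrite /unrefinable cat_path last_cat eqxx andbT andbA. Qed.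

Lemma unrefinable_last y z s : unrefinable y z s -> last y s = z.
Proof. by case/andP => _ /eqP. Qed.

Lemma unrefinable_trans y u z s t :
  unrefinable y u s -> unrefinable u z t -> unrefinable y z (s ++ t).
Proof.
by move=> ys ut; rewrite unrefinable_cat (unrefinable_last ys) ys.
Qed.

Lemma unrefinable_refl y t : unrefinable y y t -> t = [::].
Proof.
case: t => // a t; rewrite unrefinable_cons => /andP[/cover_lt ya
  /unrefinable_le].
by rewrite lt_geF.
Qed.

Lemma unrefinable_sorted y z s : unrefinable y z s -> path <%O y s.
Proof. by case/andP => + _; apply: sub_path => u v /cover_lt. Qed.

Lemma unrefinable_exists y z : y <= z -> exists s, unrefinable y z s.
Proof.
have [k] := ubnP #|[set u | y <= u <= z]|; elim: k y z => // k IH y z lek.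
rewrite le_eqVlt => /predU1P[->|yz]; first by exists [::];
  rewrite unrefinable_nil.
case: (boolP (covers y z)) => [cyz|]; first by exists [:: z];
  rewrite unrefinable_cons cyz unrefinable_nil /=.
rewrite /covers yz negbK => /existsP[u /andP[yu uz]].
have [|s ys] := IH y u _ (ltW yu).
  rewrite -ltnS; apply: leq_trans lek; rewrite ltnS; apply: proper_card;
    apply/properP; split.
    by apply/subsetP => v; rewrite !inE => /andP[-> vu];
      apply: le_trans vu (ltW uz).
  by exists z; rewrite !inE ?(ltW yz) ?lexx // (lt_geF uz) andbF.
have [|t zt] := IH u z _ (ltW uz).
  rewrite -ltnS; apply: leq_trans lek; rewrite ltnS; apply: proper_card;
    apply/properP; split.
    apply/subsetP => v; rewrite !inE => /andP[uv ->].
    by rewrite (le_trans (ltW yu) uv).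
  by exists y; rewrite !inE ?(ltW yz) ?lexx // (lt_geF yu).
by exists (s ++ t); apply: unrefinable_trans zt.
Qed.

(** The first step of the chain that lands above [b] is a cover with [b] in between, so [b] is one
    of its ends. Maximality of unrefinable chains from [\bot] to [\top] rests on this. *)
Lemma unrefinable_saturated y z s b : unrefinable y z s ->
  y <= b <= z -> {in y :: s, forall v, b >=< v} -> b \in y :: s.
Proof.
elim: s y => [|a s IH] y.
  by rewrite unrefinable_nil => /eqP <- yby _; rewrite inE; apply/eqP/le_anti;
    rewrite andbC.
rewrite unrefinable_cons => /andP[ya as_z] /andP[yb bz] cmp.
have /orP[ba|ab] : (b <= a) || (a <= b) by apply: cmp; rewrite !inE eqxx orbT.
  by have [->|->] := cover_between ya yb ba; rewrite !inE eqxx ?orbT.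
rewrite inE IH ?orbT ?ab // => v vs; apply: cmp; rewrite inE vs orbT //.
Qed.

Lemma chainP (c : {set P}) : reflect {in c &, forall u v, u >=< v} (chain c).
Proof.
apply: (iffP forall_inP) => h.
  by move=> u v uc; move/forall_inP: (h u uc); apply.
by move=> u uc; apply/forall_inP => v; apply: h.
Qed.

Lemma maximal_chain_mem (M : {set P}) b :
  maximal_chain M -> {in M, forall v, b >=< v} -> b \in M.
Proof.
move=> /maxsetP[/chainP cM maxM] cmp.
have <- : b |: M = M; last by rewrite setU11.
apply: maxM; last exact: subsetUr.
apply/chainP => u v /setU1P[->|uM] /setU1P[->|vM]; rewrite ?comparablexx //.
- exact: cmp.
- by rewrite comparable_sym cmp.
- exact: cM.
Qed.

Lemma sorted_chain (s : seq P) : sorted <=%O s -> {in s &, forall u v, u >=< v}.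
Proof.
move=> ss u v us vs.
rewrite -(nth_index u us) -(nth_index u vs) /Order.comparable.
have /orP[h|h] := leq_total (index u s) (index v s).
  by rewrite (sorted_leq_nth le_trans lexx) // inE index_mem.
by rewrite orbC (sorted_leq_nth le_trans lexx) // inE index_mem.
Qed.

Lemma sort_chain (c : {set P}) : chain c ->
  exists w : seq P, sorted <%O w /\ c = [set x in w].
Proof.
move=> /chainP cc; exists (sort <=%O (enum c)); split; last first.
  by apply/setP => x; rewrite inE mem_sort mem_enum.
rewrite lt_sorted_uniq_le sort_uniq enum_uniq /=.
(* The order is total on [c] only, so sorting is relativized to [c]. *)
apply: (@sort_sorted_in _ (mem c) <=%O).
  by move=> u v uc vc; apply: cc.
by apply/allP => x; rewrite mem_enum.
Qed.

End Unrefinable.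

Lemma path_le_last (d : Order.disp_t) (P : porderType d) (a v : P) s :
  path <=%O a s -> v \in a :: s -> v <= last a s.
Proof.
elim: s a v => [|b s IH] a v /=; first by rewrite inE => _ /eqP->.
move=> /andP[ab bs]; rewrite inE => /predU1P[->|]; last exact: (IH b _ bs).
by apply: le_trans ab _; apply: (IH b _ bs); rewrite mem_head.
Qed.

(** * Maximal chains of a bounded poset as unrefinable chains from [\bot] to [\top] *)

Section Bounded.
Context {d : Order.disp_t} {P : finTBPOrderType d}.
Implicit Types (y z u v : P) (s t : seq P).

Lemma unrefinable_maximal_chain s : unrefinable (\bot : P) \top s ->
  maximal_chain [set x in (\bot : P) :: s].
Proof.
move=> us; have ss := unrefinable_sorted us.
apply/maxsetP; split.
  apply/chainP => u v; rewrite !inE -!in_cons.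
  apply: sorted_chain; exact: (sub_path ltW).
move=> B /chainP cB sub; apply/eqP; rewrite eqEsubset sub andbT.
apply/subsetP => b bB; rewrite inE; apply: (unrefinable_saturated us).
  by rewrite le0x lex1.
by move=> v vs; apply: cB => //; apply: (subsetP sub); rewrite inE.
Qed.

(** Whatever is comparable with all of [w] already lies in [w]. This applies to [\bot] and [\top],
    and to any element strictly between two neighbours, whose index would then lie strictly between
    consecutive integers. *)
Lemma maximal_chain_unrefinable w : sorted <%O w ->
  maximal_chain [set x in w] -> exists2 s, w = (\bot : P) :: s &
    unrefinable (\bot : P) \top s.
Proof.
move=> sw mw.
have inw b : {in w, forall v, b >=< v} -> b \in w.
  move=> h; have := @maximal_chain_mem _ _ [set x in w] b mw; rewrite inE;
    apply.
  by move=> v; rewrite inE; apply: h.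
have botw : \bot \in w by apply: inw => v _; rewrite /Order.comparable le0x.
have topw : \top \in w by apply: inw => v _;
  rewrite /Order.comparable lex1 orbT.
case: w => [//|a s] in sw mw inw botw topw *.
have lea v : v \in a :: s -> a <= v.
  rewrite inE => /predU1P[->|vs] //; apply: ltW.
  by move: sw; rewrite /= (path_sortedE lt_trans) => /andP[/allP/(_ v vs)].
have ea : a = \bot by apply/le_anti; rewrite le0x lea.
rewrite {}ea {a} in sw mw inw botw topw lea *; exists s => //.
have lew : path <=%O (\bot : P) s by exact: (sub_path ltW).
apply/andP; split; last first.
  by rewrite eq_le lex1 path_le_last.
apply/(pathP \bot) => i lti; set a := nth _ _ i; set b := nth _ _ i.
have szi : (i < size ((\bot : P) :: s))%N by rewrite ltnW.
have ltab : a < b.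
  by have/(pathP \bot) := sw; apply.
rewrite /covers ltab; apply/existsPn => u; apply/negP => /andP[au ub].
have /inw uw : {in (\bot : P) :: s, forall v, u >=< v}.
  move=> v vs; rewrite -(nth_index \bot vs) /Order.comparable.
  have ltv : (index v ((\bot : P) :: s) < size ((\bot :
    P) :: s))%N by rewrite index_mem.
  have [h|h] := leqP (index v (\bot :: s)) i.
    by rewrite orbC (le_trans _ (ltW au)) // (sorted_leq_nth le_trans lexx) //.
  rewrite (le_trans (ltW ub)) // -[b]/(nth \bot (\bot :: s) i.+1).
  by rewrite (sorted_leq_nth le_trans lexx) //.
have ltu : (index u ((\bot : P) :: s) < size ((\bot :
  P) :: s))%N by rewrite index_mem.
move: au ub; rewrite -(nth_index \bot uw) -[b]/(nth \bot (\bot :: s) i.+1) /a.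
by rewrite !(lt_sorted_ltn_nth) // => h1; rewrite ltnS leqNgt h1.
Qed.
End Bounded.

(** * From labellings to left modularity *)

Section Factorization.
Context {d : Order.disp_t} {P : finTBPOrderType d}.
Implicit Types (x y z u v w : P).

Variables (L H : P -> P -> Prop) (x : P).
Hypothesis Lle : forall y z, L y z -> y <= z.
Hypothesis Hle : forall y z, H y z -> y <= z.
Hypothesis Ltrans : forall y u z, L y u -> L u z -> L y z.
Hypothesis Htrans : forall y u z, H y u -> H u z -> H y z.
Hypothesis Lconv : forall y u z, L y z -> y <= u -> u <= z -> L y u /\ L u z.
Hypothesis Hconv : forall y u z, H y z -> y <= u -> u <= z -> H y u /\ H u z.
Hypothesis factor : forall y z, y <= z -> exists2 w, L y w & H w z.
Hypothesis factor_uniq : forall y z w w',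
  L y w -> H w z -> L y w' -> H w' z -> w = w'.
Hypothesis L0x : L \bot x.
Hypothesis Hx1 : H x \top.

(** All inequalities in this section arise alike: factor an interval, compose one piece with a known
    [L] or [H] relation, and identify the factor point by uniqueness. *)
Let joinE y w : L y w -> H w \top -> join_in setT x y = Some w.
Proof.
move=> yw w1; apply/join_in_Some; split; rewrite ?inE //.
- have [v v0 vw] := factor (le0x w).
  by rewrite (factor_uniq L0x Hx1 v0 (Htrans vw w1)) Hle.
- exact: Lle.
- move=> v _ xv yv; have [_ v1] := Hconv Hx1 xv (lex1 v).
  have [u yu uv] := factor yv.
  by rewrite (factor_uniq yw w1 yu (Htrans uv v1)) Hle.
Qed.

Let meetE z w : L \bot w -> H w z -> meet_in setT x z = Some w.
Proof.
move=> w0 wz; apply/meet_in_Some; split; rewrite ?inE //.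
- have [v vw v1] := factor (lex1 w).
  by rewrite -(factor_uniq (Ltrans w0 vw) v1 L0x Hx1) Lle.
- exact: Hle.
- move=> v _ vx vz; have [v0 _] := Lconv L0x (le0x v) vx.
  have [u vu uz] := factor vz.
  by rewrite -(factor_uniq (Ltrans v0 vu) uz w0 wz) Lle.
Qed.

(** Both sides of the modular identity turn out to be the factor point [w] of the interval from [y]
    to [z]. *)
Lemma factorization_left_modular : left_modular_elt x.
Proof.
have E y z : y <= z -> exists2 w, join_meet x y z = Some w & meet_join x y z =
  Some w.
  move=> yz; have [w yw wz] := factor yz; exists w.
    have [j yj j1] := factor (lex1 y); apply/join_meet_Some.
    exists j; first exact: joinE.
    split; rewrite ?(Lle yw) ?(Hle wz) //.
      have [v wv v1] := factor (lex1 w).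
      by rewrite (factor_uniq yj j1 (Ltrans yw wv) v1) Lle.
    move=> u yu uj uz; have [yu' _] := Lconv yj yu uj.
    have [v uv vz] := factor uz.
    by rewrite (factor_uniq yw wz (Ltrans yu' uv) vz) Lle.
  have [m m0 mz] := factor (le0x z); apply/meet_join_Some.
  exists m; first exact: meetE.
  split; rewrite ?(Hle wz) ?(Lle yw) //.
    have [v v0 vw] := factor (le0x w).
    by rewrite (factor_uniq m0 mz v0 (Htrans vw wz)) Hle.
  move=> u mu yu uz; have [_ uz'] := Hconv mz mu uz.
  have [v yv vu] := factor yu.
  by rewrite (factor_uniq yw wz yv (Htrans vu uz')) Hle.
split=> y z /E[w -> ->] //.
Qed.

End Factorization.

(** * Low and high labels in an [S_n] EL-labelling *)

Section SnLabelling.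
Context {d : Order.disp_t} {P : finTBPOrderType d}.
Implicit Types (x y z u v w : P) (s t : seq P).

Lemma labels_cat (g : P -> P -> int) y s t :
  labels g (y :: s ++ t) = labels g (y :: s) ++ labels g (last y s :: t).
Proof. exact: pairmap_cat. Qed.

Variables (n : nat) (g : P -> P -> int).
Hypothesis Sn : Sn_EL_labelling n g.

Let lab y s := labels g (y :: s).

(** Extending both chains by the same pieces below [y] and above [z] gives maximal chains, whose
    labels are permutations of [1..n]; the common pieces then cancel. *)
Lemma labels_perm y z s t : unrefinable y z s -> unrefinable y z t ->
  perm_eq (lab y s) (lab y t).
Proof.
move=> ys yt.
have [a a0] := unrefinable_exists (le0x y);
  have [b b1] := unrefinable_exists (lex1 z).
have full r : unrefinable y z r ->
    perm_eq (labels g (\bot :: a ++ r ++ b)) [seq Posz i | i <- iota 1 n].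
  move=> yr; have h := unrefinable_trans a0 (unrefinable_trans yr b1).
  apply: Sn.2; last exact: unrefinable_maximal_chain.
  exact: unrefinable_sorted h.
have := full t yt; rewrite perm_sym => /(perm_trans (full s ys)).
rewrite !labels_cat (unrefinable_last a0) (unrefinable_last ys)
  (unrefinable_last yt).
by rewrite perm_cat2l perm_cat2r.
Qed.

(** The empty chain settles [y = z], which [EL_labelling] leaves out. *)
Lemma increasing_chain y z : y <= z ->
  exists s, [/\ unrefinable y z s, sorted <=%O (lab y s)
    & forall t, unrefinable y z t -> sorted <=%O (lab y t) -> t = s].
Proof.
rewrite le_eqVlt => /predU1P[->|yz]; last by have [s [? ? ? _]] := Sn.1 _ _ yz;
  exists s.
by exists [::]; split=> // [|t /unrefinable_refl //]; rewrite unrefinable_nil.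
Qed.

(** By [labels_perm], the choice of the chain [s] is immaterial. *)
Definition chain_labels (a : pred int) y z :=
  exists2 s, unrefinable y z s & all a (lab y s).

Lemma chain_labels_le a y z : chain_labels a y z -> y <= z.
Proof. by case=> s /unrefinable_le. Qed.

Lemma chain_labels_trans a y u z :
  chain_labels a y u -> chain_labels a u z -> chain_labels a y z.
Proof.
move=> [s ys sa] [t ut ta]; exists (s ++ t); first exact: unrefinable_trans ut.
by rewrite /lab labels_cat all_cat sa (unrefinable_last ys).
Qed.

Lemma chain_labels_conv a y u z : chain_labels a y z -> y <= u -> u <= z ->
  chain_labels a y u /\ chain_labels a u z.
Proof.
move=> [r yr ra] /unrefinable_exists[s ys] /unrefinable_exists[t ut].
move: ra; rewrite (perm_all _ (labels_perm yr (unrefinable_trans ys ut))).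
rewrite /lab labels_cat all_cat (unrefinable_last ys) => /andP[sa ta].
by split; [exists s|exists t].
Qed.

Lemma sorted_chain_labels a y z : chain_labels a y z ->
  exists s, [/\ unrefinable y z s, sorted <=%O (lab y s) & all a (lab y s)].
Proof.
move=> yz; have [s [ys ss _]] := increasing_chain (chain_labels_le yz).
exists s; split=> //; have [t yt ta] := yz.
by rewrite (perm_all _ (labels_perm ys yt)).
Qed.

Variable k : int.
Let low : pred int := fun i => i <= k.
Let high : pred int := fun i => k < i.

(** The increasing chain is cut just before its first label exceeding [k]. *)
Lemma low_high_factor y z : y <= z ->
  exists2 w, chain_labels low y w & chain_labels high w z.
Proof.
move=> /increasing_chain[s [ys ss _]].
elim: s y ys ss => [|u s IH] y.
  rewrite unrefinable_nil => /eqP <- _.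
  by exists y; exists [::]; rewrite ?unrefinable_nil.
move=> us ss; have [yu uz] : covers y u /\ unrefinable u z s.
  by apply/andP; rewrite -unrefinable_cons.
have [lek|ltk] := leP (g y u) k.
  have [|w uw wz] := IH u uz; first exact: path_sorted ss.
  exists w => //; apply: chain_labels_trans uw; exists [:: u].
    by rewrite unrefinable_cons yu unrefinable_nil /=.
  by rewrite /lab /= /low lek.
exists y; first by exists [::]; rewrite ?unrefinable_nil.
exists (u :: s) => //.
move: ss; rewrite /lab /= (path_sortedE le_trans) /high ltk /= => /andP[ge_g _].
by apply: sub_all ge_g => i; apply: lt_le_trans.
Qed.

(** An increasing chain with low labels followed by one with high labels is again increasing, so it
    is the increasing chain from [y] to [z]. *)
Lemma low_high_uniq y z w w' :
  chain_labels low y w -> chain_labels high w z ->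
  chain_labels low y w' -> chain_labels high w' z -> w = w'.
Proof.
move=> yw wz yw' w'z.
have yz : y <= z by apply: le_trans (chain_labels_le yw) (chain_labels_le wz).
have [r [_ _ uniq_r]] := increasing_chain yz.
(* Low labels come first on the increasing chain, so their number locates [v] on it. *)
have E v : chain_labels low y v -> chain_labels high v z ->
    v = last y (take (count low (lab y r)) r).
  move=> /sorted_chain_labels[s [ys ss sa]] /sorted_chain_labels[t [vt st ta]].
  have <- : s ++ t = r.
    apply: uniq_r; first exact: unrefinable_trans vt.
    rewrite /lab labels_cat (unrefinable_last ys).
    move: ss st; rewrite !(sorted_pairwise le_trans) pairwise_cat => -> ->.
    rewrite !andbT; apply/allrelP => i j /(allP sa) ik /(allP ta) kj.
    by apply: ltW; apply: le_lt_trans kj.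
  rewrite /lab labels_cat count_cat (unrefinable_last ys) (eqP (_ :
    count low (labels g (v :: t)) == 0%N)).
    rewrite addn0 (eqP (_ : count low (lab y s) == size s)).
      by rewrite take_size_cat // (unrefinable_last ys).
    by move: sa; rewrite all_count /lab /= size_pairmap.
  rewrite eqn0Ngt -has_count -all_predC; apply: sub_all ta => i.
  by rewrite /low /high /= -ltNge.
by rewrite (E w) // (E w').
Qed.

End SnLabelling.

Lemma Sn_EL_left_modular (d : Order.disp_t) (P : finTBPOrderType d) n :
  has_Sn_EL_labelling P n -> left_modular P.
Proof.
move=> [g Sg].
have [s [us ss _]] := increasing_chain Sg (le0x \top).
have ms := unrefinable_maximal_chain us.
exists [set x in \bot :: s] => // x; rewrite inE => xs.
have [s1 [s2 [es ex]]] : exists s1 s2, s = s1 ++ s2 /\ last \bot s1 = x.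
  by case/splitPl: xs => s1 s2 <-; exists s1, s2.
(* A sorted permutation of [1..n] is [1..n] itself. *)
have pl : labels g (\bot :: s) = [seq Posz i | i <- iota 1 n].
  apply: (sorted_eq le_trans le_anti) => //.
    by rewrite sorted_map; apply: iota_sorted.
  by apply: Sg.2 => //; apply: unrefinable_sorted us.
move: us; rewrite es unrefinable_cat ex => /andP[us1 us2].
move: pl; rewrite es labels_cat ex => pl.
(* The threshold is the rank of [x]: the increasing chain has labels [1..k] below [x] and larger
   ones above. *)
pose k := Posz (size s1).
have sz1 : size (labels g (\bot :: s1)) = size s1 by rewrite /= size_pairmap.
have sz : (size s1 <= n)%N.
  by have /(congr1 size) := pl; rewrite size_cat sz1 size_map size_iota => <-;
    apply: leq_addr.
have e1 : labels g (\bot :: s1) = [seq Posz i | i <- iota 1 (size s1)].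
  have := congr1 (take (size s1)) pl.
  by rewrite take_size_cat // -map_take take_iota (minn_idPl sz).
have e2 : labels g (x :: s2) =
  [seq Posz i | i <- iota (1 + size s1) (n - size s1)].
  have := congr1 (drop (size s1)) pl.
  by rewrite drop_size_cat // -map_drop drop_iota.
apply: (@factorization_left_modular _ _ (chain_labels g (fun i => i <= k))
  (chain_labels g (fun i => k < i))).
- exact: chain_labels_le.
- exact: chain_labels_le.
- exact: chain_labels_trans.
- exact: chain_labels_trans.
- exact: (chain_labels_conv Sg).
- exact: (chain_labels_conv Sg).
- exact: (low_high_factor Sg).
- exact: (low_high_uniq Sg).
- exists s1 => //; rewrite e1 all_map; apply/allP => i.
  by rewrite mem_iota => /andP[_]; rewrite ltnS.
- exists s2 => //; rewrite e2 all_map; apply/allP => i.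
  by rewrite mem_iota => /andP[].
Qed.

(** * From left modularity to labellings and supersolvability *)

(** The head of a sorted list is a minimum, so the lists differ strictly there or share it. Labels
    of an interval being fixed up to order, the lexicographic clause of [EL_labelling] thus follows
    from uniqueness of the increasing chain. *)
Lemma sorted_perm_ltxi (d : Order.disp_t) (T : orderType d) (s t : seq T) :
  perm_eq s t -> sorted <=%O s -> s != t -> (s : seqlexi T) < t.
Proof.
elim: s t => [|a s IH] [|b t].
- by rewrite eqxx.
- by move/perm_size.
- by move/perm_size.
move=> pst; rewrite [sorted _ _]/= (path_sortedE le_trans) => /andP[/allP amin
  ss] nst.
have ab : a <= b.
  have : b \in a :: s by rewrite (perm_mem pst) mem_head.
  by rewrite inE => /predU1P[->|/amin].
rewrite ltxi_cons ab /=; apply/implyP => ba.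
have Eab : a = b by apply/le_anti; rewrite ab.
rewrite Eab perm_cons in pst; apply: IH => //.
by move: nst; rewrite Eab; apply: contra => /eqP->.
Qed.

(** * Distributivity of rings of sets *)

Section RingOfSets.
Context {d : Order.disp_t} {P : finPOrderType d} {T : finType}.
Variables (h : P -> {set T}) (R : {set P}).
Hypothesis h_mono : {in R &, forall u v, (h u \subset h v) = (u <= v)}.

Let meetE u v w : u \in R -> v \in R -> w \in R ->
  h w = h u :&: h v -> meet_in R u v = Some w.
Proof.
move=> uR vR wR hw; apply/meet_in_Some;
  rewrite -!h_mono // hw subsetIl subsetIr.
split=> // t tR; rewrite -!h_mono // => tu tv.
by rewrite hw subsetI tu.
Qed.

Let joinE u v w : u \in R -> v \in R -> w \in R ->
  h w = h u :|: h v -> join_in R u v = Some w.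
Proof.
move=> uR vR wR hw; apply/join_in_Some;
  rewrite -!h_mono // hw subsetUl subsetUr.
split=> // t tR; rewrite -!h_mono // => tu tv.
by rewrite hw subUset tu.
Qed.

(** Through the embedding [h], meets and joins in [R] become intersections and unions, so
    distributivity is that of sets. *)
Lemma ring_of_sets_distributive :
  {in R &, forall u v, exists2 w, w \in R & h w = h u :&: h v} ->
  {in R &, forall u v, exists2 w, w \in R & h w = h u :|: h v} ->
  distributive_lattice R.
Proof.
move=> hI hU; split=> [u v uR vR|x y z xR yR zR j a b].
  have [w wR /(meetE uR vR wR)->] := hI u v uR vR.
  by have [w' w'R /(joinE uR vR w'R)->] := hU u v uR vR.
have [j' jR hj] := hU y z yR zR; rewrite (joinE yR zR jR hj) => -[<-].
have [a' aR ha] := hI x y xR yR; rewrite (meetE xR yR aR ha) => -[<-].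
have [b' bR hb] := hI x z xR zR; rewrite (meetE xR zR bR hb) => -[<-].
have [m mR hm] := hI x j' xR jR; rewrite (meetE xR jR mR hm);
  apply/esym/joinE => //.
by rewrite hm hj ha hb setIUr.
Qed.

End RingOfSets.

(** * Label sets of a left modular chain *)

Section LeftModularChain.
Context {d : Order.disp_t} {P : finTBPOrderType d}.
Implicit Types (x y z u v w : P) (s t : seq P).

(** The chain is indexed by all naturals and stays at [\top] from [n] on, which avoids range
    conditions on indices. *)
Variables (n : nat) (xs : nat -> P).
Hypothesis xs0 : xs 0 = \bot.
Hypothesis xsn : xs n = \top.
Hypothesis xs_mono : {homo xs : i j / (i <= j)%N >-> i <= j}.
Hypothesis xs_lt : forall i, (i < n)%N -> xs i < xs i.+1.
Hypothesis xs_cover : forall i u,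
  xs i <= u -> u <= xs i.+1 -> u = xs i \/ u = xs i.+1.
Hypothesis xs_modular : forall i, left_modular_elt (xs i).
Hypothesis size_unrefinable :
  forall s, unrefinable \bot \top s -> size s = n.

(** The default [y] never occurs when [y <= z], by [cut_Some]. *)
Definition cut m y z := odflt y (join_meet (xs m) y z).

Lemma cut_Some m y z : y <= z ->
  join_meet (xs m) y z = Some (cut m y z) /\ meet_join (xs m) y z =
    Some (cut m y z).
Proof.
by move=> /(left_modular_split (xs_modular m))[u [jm mj] _]; rewrite /cut jm mj.
Qed.

Lemma cut_split m y z : y <= z -> split_at (xs m) y z (cut m y z).
Proof.
by move=> /(left_modular_split (xs_modular m))[u [jm mj] [us _]];
  rewrite /cut jm.
Qed.

Lemma cut_uniq m y z u : split_at (xs m) y z u -> u = cut m y z.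
Proof.
move=> us; have yz : y <= z by case/and4P: us => yu uz _ _; apply: le_trans uz.
have [v [jm _] [_ uniq]] := left_modular_split (xs_modular m) yz.
by rewrite /cut jm /=; apply: uniq.
Qed.

Lemma le_cut m y z : y <= z -> y <= cut m y z.
Proof. by case/(cut_split m)/and4P. Qed.

Lemma cut_le m y z : y <= z -> cut m y z <= z.
Proof. by case/(cut_split m)/and4P. Qed.

Lemma lo_cut m y z : y <= z -> lo (xs m) y (cut m y z).
Proof. by case/(cut_split m)/and4P. Qed.

Lemma hi_cut m y z : y <= z -> hi (xs m) (cut m y z) z.
Proof. by case/(cut_split m)/and4P. Qed.

(** Both [y] and [z] split the interval, and the split point is unique. *)
Lemma lo_hi_eq m y z : y <= z -> lo (xs m) y z -> hi (xs m) y z -> y = z.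
Proof.
move=> yz l h; transitivity (cut m y z).
  by apply: cut_uniq; rewrite /split_at lexx yz lo_refl.
by apply/esym/cut_uniq; rewrite /split_at lexx yz hi_refl l.
Qed.

Lemma cut_lo m y z : y <= z -> lo (xs m) y z -> cut m y z = z.
Proof. by move=> yz l; apply/esym/cut_uniq;
  rewrite /split_at yz lexx l hi_refl. Qed.

Lemma cut_hi m y z : y <= z -> hi (xs m) y z -> cut m y z = y.
Proof. by move=> yz h; apply/esym/cut_uniq;
  rewrite /split_at yz lexx h lo_refl. Qed.

Lemma lo_xs i j y z : (i <= j)%N -> lo (xs i) y z -> lo (xs j) y z.
Proof. by move=> /xs_mono; apply: lo_le. Qed.

Lemma hi_xs i j y z : (i <= j)%N -> hi (xs j) y z -> hi (xs i) y z.
Proof. by move=> /xs_mono; apply: hi_le. Qed.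

Lemma lo0 y z : y <= z -> lo (xs 0) y z -> y = z.
Proof.
move=> yz; rewrite xs0 => /loP/(_ y (le0x y) (lexx y)) zy.
by apply/le_anti; rewrite yz.
Qed.

Lemma lo_n y z : lo (xs n) y z.
Proof. by rewrite xsn; apply/loP => u u1 _; apply: le_trans (lex1 z) u1. Qed.

Lemma hi0 y z : hi (xs 0) y z.
Proof. by rewrite xs0; apply/hiP => u u0 _; apply: le_trans u0 (le0x y). Qed.

(** The element [cut i y z] is also [xs j]-low over [y], so cutting at [j] from there or from [y]
    gives the same result. *)
Lemma cut_mono_r i j y z z' : (i <= j)%N -> y <= z -> z <= z' ->
  cut i y z <= cut j y z'.
Proof.
move=> ij yz zz'; have cz' := le_trans (cut_le i yz) zz'.
rewrite (_ : cut j y z' = cut j (cut i y z) z') ?le_cut //.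
apply/esym/cut_uniq; rewrite /split_at cut_le // hi_cut // !andbT.
rewrite (le_trans (le_cut i yz)) ?le_cut //=.
by apply: lo_trans (lo_cut j cz'); apply: lo_xs ij (lo_cut i yz).
Qed.

Lemma cut_mono_l i y y' z : y <= y' -> y' <= z -> cut i y z <= cut i y' z.
Proof.
move=> yy' y'z; have yc := le_trans yy' (le_cut i y'z).
rewrite (_ : cut i y z = cut i y (cut i y' z)) ?cut_le //.
apply/esym/cut_uniq; rewrite /split_at le_cut // lo_cut //=.
rewrite (le_trans (cut_le i yc)) ?cut_le //=.
by apply: hi_trans (hi_cut i yc) (hi_cut i y'z).
Qed.

Lemma cut_mono i j y y' z z' : (i <= j)%N -> y <= z -> y' <= z' ->
  y <= y' -> z <= z' -> cut i y z <= cut j y' z'.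
Proof.
move=> ij yz y'z' yy' zz'; apply: (le_trans (cut_mono_r ij yz zz')).
exact: cut_mono_l.
Qed.

(** This is [xs m /\ z], as the next three lemmas show. *)
Let meet m z := cut m \bot z.

Lemma meet_le_xs m z : meet m z <= xs m.
Proof. by have /loP := lo_cut m (le0x z); apply; rewrite ?le0x. Qed.

Lemma meet_le m z : meet m z <= z. Proof. exact: cut_le. Qed.

Lemma le_meet m u z : u <= xs m -> u <= z -> u <= meet m z.
Proof. by have /hiP := hi_cut m (le0x z); apply. Qed.

(** The pair [(u, b)] would be both high and low for [xs m], against [lo_hi_eq]. Highness holds
    because anything below [xs m] and [b] is below [a]. *)
Lemma meet_cover m u z : meet m z < u -> u < meet m.+1 z -> False.
Proof.
set a := meet m z; set b := meet m.+1 z => au ub.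
have ux : u <= xs m.+1 := le_trans (ltW ub) (meet_le_xs _ _).
have bz : b <= z := meet_le _ _.
have uz : u <= z := le_trans (ltW ub) bz.
suff lub : lo (xs m) u b.
  have hub : hi (xs m) u b.
    apply/hiP => v vx vb; apply: le_trans (ltW au).
    by apply: le_meet => //; apply: le_trans bz.
  by have := lo_hi_eq (ltW ub) lub hub; move: ub => /[swap] ->; rewrite ltxx.
(* [J] is the join of [xs m] and [u]. It must be [xs m] or [xs m.+1], and the former would give
   [u <= a]. *)
set J := cut m u \top.
have lJ : lo (xs m) u J := lo_cut m (lex1 u).
have xJ : xs m <= J by have /hiP := hi_cut m (lex1 u); apply; rewrite ?lex1.
have Jx : J <= xs m.+1 by move/loP: lJ; apply => //; apply: xs_mono.
have [EJ|EJ] := xs_cover xJ Jx.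
  have /le_meet/(_ uz) : u <= xs m by rewrite -EJ le_cut ?lex1.
  by rewrite -/a (lt_geF au).
by apply: lo_sub lJ => //; rewrite EJ meet_le_xs.
Qed.

(* The labels of the maximal chains from [\bot] to [z] under [label] below,
   shifted to start from 0. *)
Definition label_set z : {set 'I_n} := [set i : 'I_n | meet i z < meet i.+1 z].

Lemma meet_mono_l i j z : (i <= j)%N -> meet i z <= meet j z.
Proof. by move=> ij; apply: cut_mono_r. Qed.

Lemma notin_label_set i z : (i \notin label_set z) = (meet i.+1 z <= xs i).
Proof.
rewrite inE lt_neqAle meet_mono_l // andbT negbK; apply/eqP/idP => [<-|h].
  exact: meet_le_xs.
by apply/le_anti; rewrite meet_mono_l //= le_meet ?meet_le.
Qed.

Lemma label_set_mono y z : y <= z -> label_set y \subset label_set z.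
Proof.
move=> yz; apply/subsetP => i; apply: contraLR; rewrite !notin_label_set.
by apply: le_trans; apply: cut_mono_r.
Qed.

Lemma label_set0 : label_set \bot = set0.
Proof.
apply/setP => i; rewrite in_set0; apply/negbTE; rewrite notin_label_set.
by rewrite (le_trans (meet_le _ _)) ?le0x.
Qed.

Lemma label_setT : label_set \top = setT.
Proof.
apply/setP => i; rewrite in_setT; apply/negbNE/negP;
  rewrite notin_label_set => h.
have := xs_lt (ltn_ord i); rewrite le_gtF // (le_trans _ h) //.
by apply: le_meet; rewrite ?lex1.
Qed.

(** Take the least [m] for which [(y, z)] is [xs m]-low; it is positive, and the label is its
    predecessor [l]. Minimality leaves [y] as the only possible value of [cut l y z], so the pair is
    [xs l]-high. *)
Lemma cover_new_label y z : covers y z ->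
  exists l : 'I_n, [/\ l \in label_set z, l \notin label_set y, hi (xs l) y z &
    lo (xs l.+1) y z].
Proof.
move=> yz; have ltyz := cover_lt yz; have leyz := ltW ltyz.
have exlo : exists m, lo (xs m) y z by exists n; apply: lo_n.
case: (ex_minnP exlo) => -[|l] lol minl.
  by move: ltyz; rewrite (lo0 leyz lol) ltxx.
have ltln : (l < n)%N by apply: minl; apply: lo_n.
have hil : hi (xs l) y z.
  have [E|E] := cover_between yz (le_cut l leyz) (cut_le l leyz).
    by have := hi_cut l leyz; rewrite E.
  by have := lo_cut l leyz; rewrite E => /minl; rewrite ltnn.
have mly : meet l z <= y by move/hiP: hil; apply; rewrite ?meet_le ?meet_le_xs.
have mSly : ~~ (meet l.+1 z <= y).
  apply/negP => h; suff: hi (xs l.+1) y z.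
    by move/(lo_hi_eq leyz lol) => E; rewrite E ltxx in ltyz.
  by apply/hiP => v vx vz; apply: le_trans h; apply: le_meet.
exists (Ordinal ltln); split=> //.
  apply/negbNE/negP; rewrite notin_label_set /= => h; case/negP: mSly.
  by apply: le_trans mly; apply: le_meet h (meet_le _ _).
(* If [l] were already a label of [y], then [meet l.+1 y] would lie strictly between [meet l z] and
   [meet l.+1 z]. *)
apply/negP; rewrite inE /= => h.
have E : meet l z = meet l y.
  by apply/le_anti; rewrite le_meet ?meet_le_xs //= cut_mono_r.
apply: (@meet_cover l (meet l.+1 y) z); first by rewrite E.
rewrite lt_neqAle (cut_mono_r _ (le0x y) leyz) // andbT.
by apply: contra mSly => /eqP <-; apply: meet_le.
Qed.

Lemma card_label_set_path y z s : unrefinable y z s ->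
  (#|label_set y| + size s <= #|label_set z|)%N.
Proof.
elim: s y => [|u s IH] y; first by rewrite unrefinable_nil addn0 => /eqP->.
rewrite unrefinable_cons => /andP[yu uz]; apply: leq_trans (IH u uz).
rewrite addnS -addSn leq_add2r; apply: proper_card; apply/properP; split.
  exact/label_set_mono/ltW/cover_lt.
by have [l [lu ly _ _]] := cover_new_label yu; exists l.
Qed.

(* [label_set] grows strictly along each cover of a maximal chain; as this chain
   has [n] covers and there are only [n] labels, it grows by one each time. *)
Lemma cover_label_set y z : covers y z ->
  exists l : 'I_n, [/\ l \notin label_set y, label_set z = l |: label_set y,
    hi (xs l) y z & lo (xs l.+1) y z].
Proof.
move=> yz; have [l [lz ly hl ll]] := cover_new_label yz; exists l; split=> //.
apply/eqP; rewrite eq_sym eqEcard subUset sub1set lz label_set_mono ?ltW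
  ?cover_lt //=.
rewrite cardsU1 ly add1n.
have [s s0] := unrefinable_exists (le0x y);
  have [t t1] := unrefinable_exists (lex1 z).
have yzt : unrefinable y \top (z :: t) by rewrite unrefinable_cons yz.
have := size_unrefinable (unrefinable_trans s0 yzt); rewrite size_cat /= => En.
have := card_label_set_path s0; rewrite label_set0 cards0 add0n => les.
have := card_label_set_path t1; rewrite label_setT cardsT card_ord => let_n.
have : (#|label_set z| + size t <= size s + (size t).+1)%N by rewrite En.
by rewrite addnS -addSn leq_add2r => /leq_trans; apply.
Qed.

(** Induction along an unrefinable chain. A cover with label [l] is [xs l.+1]-low and [xs l]-high,
    so by [lo_hi_eq] it is [xs m]-low only if [l < m]. *)
Lemma lo_label_set m y z : y <= z ->
  lo (xs m) y z <-> {in label_set z :\: label_set y, forall i : 'I_n,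
  (i < m)%N}.
Proof.
move=> /unrefinable_exists[s]; elim: s y => [|u s IH] y.
  by rewrite unrefinable_nil => /eqP->; split=> [_ i|_];
    rewrite ?lo_refl // setDv inE.
rewrite unrefinable_cons => /andP[yu uz].
have [l [ly Su hl ll]] := cover_label_set yu.
have lequ := ltW (cover_lt yu); have leuz := unrefinable_le uz.
split=> [lom i|h].
  have /(IH _ uz) h : lo (xs m) u z by apply: lo_sub lom.
  rewrite inE => /andP[iy iz]; have [iu|iu] := boolP (i \in label_set u);
    last first.
    by apply: h; rewrite inE iu.
  move: iu; rewrite Su in_setU1 (negbTE iy) orbF => /eqP->.
  rewrite ltnNge; apply/negP => ml; have := cover_lt yu.
  rewrite (lo_hi_eq lequ _ hl) ?ltxx //.
  by apply: lo_xs ml _; apply: lo_sub lom.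
apply: (@lo_trans _ _ _ u).
  apply: lo_xs ll; apply: h; rewrite inE ly /=.
  by apply: (subsetP (label_set_mono leuz)); rewrite Su setU11.
apply/(IH _ uz) => i; rewrite inE => /andP[iu iz]; apply: h;
  rewrite inE iz andbT.
by apply: contra iu; apply/subsetP/label_set_mono.
Qed.

(** Dual to [lo_label_set]. *)
Lemma hi_label_set m y z : y <= z ->
  hi (xs m) y z <-> {in label_set z :\: label_set y, forall i : 'I_n,
  (m <= i)%N}.
Proof.
move=> /unrefinable_exists[s]; elim: s y => [|u s IH] y.
  by rewrite unrefinable_nil => /eqP->; split=> [_ i|_];
    rewrite ?hi_refl // setDv inE.
rewrite unrefinable_cons => /andP[yu uz].
have [l [ly Su hl ll]] := cover_label_set yu.
have lequ := ltW (cover_lt yu); have leuz := unrefinable_le uz.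
split=> [him i|h].
  have /(IH _ uz) h : hi (xs m) u z by apply: hi_sub him.
  rewrite inE => /andP[iy iz]; have [iu|iu] := boolP (i \in label_set u);
    last first.
    by apply: h; rewrite inE iu.
  move: iu; rewrite Su in_setU1 (negbTE iy) orbF => /eqP->.
  rewrite leqNgt; apply/negP => ml; have := cover_lt yu.
  rewrite (lo_hi_eq lequ ll) ?ltxx //.
  by apply: hi_xs ml _; apply: hi_sub him.
apply: (@hi_trans _ _ _ u).
  apply: hi_xs hl; apply: h; rewrite inE ly /=.
  by apply: (subsetP (label_set_mono leuz)); rewrite Su setU11.
apply/(IH _ uz) => i; rewrite inE => /andP[iu iz]; apply: h;
  rewrite inE iz andbT.
by apply: contra iu; apply/subsetP/label_set_mono.
Qed.

(** Without new labels the pair is low for [xs 0 = \bot]. *)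
Lemma label_set_inj y z : y <= z -> label_set z \subset label_set y -> y = z.
Proof.
move=> yz; rewrite -setD_eq0 => /eqP E.
by apply: lo0 => //; apply/(lo_label_set _ yz) => i; rewrite E inE.
Qed.

(** Labels gained up to the split point are below [m] by lowness, those gained after it are at least
    [m] by highness. *)
Lemma label_set_cut m y z : y <= z ->
  label_set (cut m y z) = label_set y :|: [set i in label_set z | (i < m)%N].
Proof.
move=> yz; have yc := le_cut m yz; have cz := cut_le m yz.
have /(lo_label_set _ yc) l := lo_cut m yz;
  have /(hi_label_set _ cz) h := hi_cut m yz.
apply/setP => i; rewrite in_setU inE; apply/idP/idP => [ic|].
  have [//|/= iy] := boolP (i \in label_set y).
  by rewrite (subsetP (label_set_mono cz)) //= l // inE iy.
case/orP => [|/andP[iz im]]; first exact/subsetP/label_set_mono.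
apply/negbNE/negP => ic; have := h i; rewrite inE ic iz => /(_ isT).
by rewrite leqNgt im.
Qed.

(** Converse of [label_set_cut]: a split point can be recognized by its labels alone. *)
Lemma cut_label_set m y z u : y <= u -> u <= z ->
  label_set u = label_set y :|: [set i in label_set z | (i < m)%N] ->
    u = cut m y z.
Proof.
move=> yu uz E; apply: cut_uniq; rewrite /split_at yu uz /=; apply/andP; split.
  apply/(lo_label_set _ yu) => i.
  by rewrite E in_setD in_setU => /andP[/negbTE->]; rewrite inE => /andP[].
apply/(hi_label_set _ uz) => i;
  rewrite E in_setD in_setU negb_or -andbA => /and3P[_ + iz].
by rewrite inE iz -leqNgt.
Qed.

(** The successor shifts ordinals [0..n-1] to labels [1..n]. On a cover the difference is a
    singleton, so nothing depends on the pick and the default [0] does not occur. *)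
Definition label y z : int :=
  if [pick i in label_set z :\: label_set y] is Some i then Posz i.+1 else Posz
    0.

Lemma label_cover y z : covers y z -> exists l : 'I_n,
  [/\ l \notin label_set y, label_set z = l |: label_set y & label y z =
    Posz l.+1].
Proof.
move=> /cover_label_set[l [ly Sz _ _]]; exists l; split=> //.
rewrite /label; case: pickP => [i|/(_ l)];
  rewrite Sz in_setD !in_setU1 ?eqxx ?ly //.
by case/andP => /negbTE->; rewrite orbF => /eqP->.
Qed.

Lemma labels_perm_label_set y z s : unrefinable y z s ->
  perm_eq (labels label (y :: s))
          [seq Posz i.+1 | i : 'I_n <- enum (label_set z :\: label_set y)].
Proof.
elim: s y => [|u s IH] y; first by rewrite unrefinable_nil => /eqP->;
  rewrite setDv enum_set0.
rewrite unrefinable_cons => /andP[yu uz].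
have [l [ly Su El]] := label_cover yu.
have Sz := label_set_mono (unrefinable_le uz).
have -> : labels label (y :: u :: s) = label y u :: labels label (u :: s) by [].
have : perm_eq (label y u :: labels label (u :: s)) (label y u :: [seq Posz
  i.+1 | i : 'I_n <- enum (label_set z :\: label_set u)]).
  by rewrite perm_cons IH.
move/perm_trans; apply; rewrite El -map_cons; apply/perm_map/uniq_perm.
- by rewrite /= enum_uniq mem_enum Su in_setD setU11.
- exact: enum_uniq.
move=> i; rewrite in_cons !mem_enum !in_setD Su in_setU1.
have [->|_] //= := eqVneq i l.
by rewrite ly; apply/esym/(subsetP Sz); rewrite Su setU11.
Qed.

Lemma mem_labels y z s (i : 'I_n) : unrefinable y z s ->
  (Posz i.+1 \in labels label (y :: s)) = (i \in label_set z :\: label_set y).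
Proof.
move=> /labels_perm_label_set/perm_mem->.
by rewrite mem_map ?mem_enum // => j k [] /ord_inj.
Qed.

(** An increasing chain must first take the least new label [l], and only one cover of [y] below [z]
    carries it. Induction on the number of new labels does the rest. *)
Lemma increasing_label_chain y z : y <= z ->
  exists s, [/\ unrefinable y z s, sorted <=%O (labels label (y :: s))
    & forall t, unrefinable y z t -> sorted <=%O (labels label (y :: t)) ->
      t = s].
Proof.
have [k] := ubnP #|label_set z :\: label_set y|.
elim: k y => // k IH y ltk yz.
have [D0|[l0 l0D]] := set_0Vmem (label_set z :\: label_set y).
  have <- : y = z by apply: label_set_inj yz _; rewrite -setD_eq0 D0.
  by exists [::]; split=> // [|t /unrefinable_refl //]; rewrite unrefinable_nil.
pose l := [arg min_(i < l0 in label_set z :\: label_set y) (i : nat)]%N.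
have [lD lmin] : l \in label_set z :\: label_set y
    /\ {in label_set z :\: label_set y, forall i : 'I_n, (l <= i)%N}.
  by rewrite /l; case: arg_minnP.
have /setDP[lz ly] := lD.
(* By minimality [l] is the only new label below [l.+1], so this cut adds just [l]. *)
pose u := cut l.+1 y z.
have yu : y <= u := le_cut _ yz; have uz : u <= z := cut_le _ yz.
have Su : label_set u = l |: label_set y.
  rewrite label_set_cut //; apply/setP => i; rewrite in_setU in_setU1 orbC.
  have [|iy] := boolP (i \in label_set y); first by rewrite !orbT.
  rewrite !orbF inE; apply/andP/eqP => [[iz]|->]; last by rewrite lz.
  rewrite ltnS => il; apply/ord_inj/eqP; rewrite eqn_leq il lmin //.
  by rewrite in_setD iy.
have cyu : covers y u.
  have neq : y != u by apply: contra ly => /eqP->; rewrite Su setU11.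
  rewrite /covers lt_neqAle neq yu; apply/existsPn => v;
    apply/negP => /andP[yv vu].
  have [lv|lv] := boolP (l \in label_set v).
    move: (vu); rewrite (label_set_inj (ltW vu)) ?ltxx //.
    by rewrite Su subUset sub1set lv label_set_mono ?ltW.
  move: (yv); rewrite (label_set_inj (ltW yv)) ?ltxx //; apply/subsetP => i iv.
  have := subsetP (label_set_mono (ltW vu)) _ iv; rewrite Su => /setU1P[Ei|//].
  by rewrite -Ei iv in lv.
have [l' [_ _ Elab]] := label_cover cyu.
have {l' Elab} Elab : label y u = Posz l.+1.
  have := mem_labels l (_ : unrefinable y u [:: u]).
  rewrite unrefinable_cons cyu unrefinable_nil eqxx => /(_ isT).
  by rewrite in_setD ly Su setU11 inE => /eqP.
have [|s [us ss suniq]] := IH u _ uz.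
  rewrite -ltnS; apply: leq_trans ltk; rewrite ltnS; apply: proper_card.
  apply/properP; split; first exact/setDS/label_set_mono.
  by exists l; rewrite ?lD // in_setD Su setU11.
have yzs : unrefinable y z (u :: s) by rewrite unrefinable_cons cyu.
exists (u :: s); split=> //.
  rewrite /= (path_sortedE le_trans) ss andbT; apply/allP => a.
  move=> /[dup] as_; rewrite (perm_mem (labels_perm_label_set us)).
  case/mapP => i; rewrite mem_enum => iD ->; rewrite Elab lez_nat ltnS.
  by apply: lmin; apply: (subsetP _ _ iD); apply/setDS/label_set_mono.
case=> [|v t]; first by rewrite unrefinable_nil => /eqP Eyz;
  rewrite Eyz lz in ly.
move=> yzt; have := yzt; rewrite unrefinable_cons => /andP[yv vz].
rewrite [sorted _ _]/= (path_sortedE le_trans) => /andP[/allP lab_min st].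
have [l' [l'y Sv El']] := label_cover yv.
(* The label of [l] occurs somewhere on the chain, and the first label [l'.+1] is the smallest
   there. *)
have Ell' : l' = l.
  apply/ord_inj/eqP; rewrite eqn_leq lmin ?andbT; last first.
    by rewrite in_setD l'y; apply: (subsetP (label_set_mono (unrefinable_le
      vz))); rewrite Sv setU11.
  have := mem_labels l yzt;
    rewrite lD [labels _ _]/= inE El' => /predU1P[[->] //|].
  by move/lab_min; rewrite El' lez_nat ltnS.
have Evu : v = u.
  apply: cut_label_set; [exact/ltW/cover_lt|exact: unrefinable_le vz|].
  by rewrite -label_set_cut // -/u Sv Su Ell'.
by rewrite Evu in vz st *; rewrite (suniq t).
Qed.

Lemma label_Sn_EL : Sn_EL_labelling n label.
Proof.
split=> [y z yz|w sw mw].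
  have [s [ys ss suniq]] := increasing_label_chain (ltW yz).
  exists s; split=> // t yt ts; apply: sorted_perm_ltxi => //.
    have := labels_perm_label_set yt; rewrite perm_sym.
    exact: perm_trans (labels_perm_label_set ys).
  by apply: contraNneq ts => E; apply/eqP/suniq; rewrite -?E.
have [s -> us] := maximal_chain_unrefinable sw mw.
apply: perm_trans (labels_perm_label_set us) _.
rewrite label_setT label_set0 setD0 enum_setT (iotaDl 1 0 n) -map_comp
  -val_enum_ord -map_comp enumT.
exact: perm_refl.
Qed.

(* In a lattice, sweeping [c_1 <= ... <= c_r] from [\bot] yields the join of the
   [x_(i c_k) /\ c_k] whenever [i] is weakly decreasing. *)
Definition sweep (i : P -> nat) u s := foldl (fun v c => cut (i c) v c) u s.

(** By [label_set_cut], passing [c] adjoins the labels of [c] below [i c]. *)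
Lemma label_set_sweep i u s : path <=%O u s -> label_set (sweep i u s) =
  label_set u :|: [set a : 'I_n | has (fun c => (a \in label_set c) && (a < i
    c)%N) s].
Proof.
elim: s u => [|c s IH] u /=.
  by move=> _; apply/setP => a; rewrite in_setU [X in _ || X]in_set orbF.
move=> /andP[uc cs]; rewrite IH;
  last exact: (path_le le_trans (cut_le _ uc) cs).
by rewrite label_set_cut // -setUA; congr (_ :|: _); apply/setP => a;
  rewrite in_setU !in_set.
Qed.

Lemma sweep_mono i j u v s : path <=%O u s -> path <=%O v s -> u <= v ->
  {in s, forall c, (i c <= j c)%N} -> sweep i u s <= sweep j v s.
Proof.
elim: s u v => [|c s IH] u v //= /andP[uc cs] /andP[vc _] uv ij.
apply: IH.
- exact: (path_le le_trans (cut_le _ uc) cs).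
- exact: (path_le le_trans (cut_le _ vc) cs).
- by apply: cut_mono => //; apply: ij; rewrite mem_head.
- by move=> b bs; apply: ij; rewrite in_cons bs orbT.
Qed.

Lemma sweep_le i u s : path <=%O u s -> sweep i u s <= last u s.
Proof.
elim: s u => //= c s IH u /andP[uc cs].
apply: le_trans (IH _ (path_le le_trans (cut_le _ uc) cs)) _.
by case: s cs {IH} => [|b s] //= _; apply: cut_le.
Qed.

(** * Sweeps along a chain and the sublattice it generates *)

Section Sweep.
Variable s : seq P.
Hypothesis s_sorted : sorted <%O s.
Hypothesis top_s : \top \in s.
Implicit Types i j : P -> nat.

(** This condition lets pointwise minima of cutoffs correspond to intersections of label sets. *)
Definition antitone i := {in s &, forall b c, b <= c -> (i c <= i b)%N}.

(* The proofs below clear the body of [Phi], which [rewrite] would otherwise unfold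
   in its failed comparisons. *)
Let Phi i := sweep i \bot s.

Let path_s : path <=%O \bot s.
Proof.
rewrite path_min_sorted ?(sub_sorted ltW) //.
by apply/allP => c _; apply: le0x.
Qed.

Let in_Phi i (a : 'I_n) : (a \in label_set (Phi i)) =
  has (fun c => (a \in label_set c) && (a < i c)%N) s.
Proof. by rewrite label_set_sweep // label_set0 set0U in_set. Qed.

Let Phi_mono i j : {in s, forall c, (i c <= j c)%N} -> Phi i <= Phi j.
Proof. exact: sweep_mono. Qed.

(** If [b] witnesses a label for [i] and [c] for [j], the smaller of the two witnesses it for both,
    since cutoffs are no smaller there. *)
Let label_set_Phi_min i j : antitone i -> antitone j ->
  label_set (Phi (fun c => minn (i c) (j c))) =
    label_set (Phi i) :&: label_set (Phi j).
Proof.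
clearbody Phi; move=> ai aj; apply/setP => a; rewrite in_setI !in_Phi.
apply/hasP/andP => [[c cs]|[]].
  by rewrite leq_min => /and3P[ac ic jc]; split; apply/hasP; exists c;
    rewrite ?ac.
move=> /hasP[b bs /andP[ab ib]] /hasP[c cs /andP[ac jc]].
have /orP[le_bc|le_cb] : b >=< c by apply: (sorted_chain (sub_sorted ltW
  s_sorted)).
  by exists b; rewrite // ab leq_min ib (leq_trans jc) ?aj.
by exists c; rewrite // ac leq_min jc (leq_trans ib) ?ai.
Qed.

Let label_set_Phi_max i j :
  label_set (Phi (fun c => maxn (i c) (j c))) =
    label_set (Phi i) :|: label_set (Phi j).
Proof.
clearbody Phi; apply/setP => a; rewrite in_setU !in_Phi -has_predU.
apply: eq_has => c /=.
by rewrite leq_max andb_orr.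
Qed.

Lemma antitone_min i j : antitone i -> antitone j ->
  antitone (fun c => minn (i c) (j c)).
Proof.
move=> ai aj b c bs cs bc; rewrite leq_min !geq_min ai //=.
by rewrite aj ?orbT.
Qed.

Lemma antitone_max i j : antitone i -> antitone j ->
  antitone (fun c => maxn (i c) (j c)).
Proof.
move=> ai aj b c bs cs bc; rewrite geq_max !leq_max ai //=.
by rewrite aj ?orbT.
Qed.

Lemma antitone_const m : antitone (fun=> m).
Proof. by []. Qed.

(** [label_set_inj] needs comparable elements; the pointwise minimum supplies one below [Phi i] with
    the same labels. Hence [label_set] reflects the order on sweeps. *)
Let Phi_min i j : antitone i -> antitone j ->
  label_set (Phi i) \subset label_set (Phi j) ->
  Phi (fun c => minn (i c) (j c)) = Phi i.
Proof.
clearbody Phi; move=> ai aj sub; apply: label_set_inj.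
  by apply: Phi_mono => c _; apply: geq_minl.
by rewrite (label_set_Phi_min ai aj) subsetI sub andbT.
Qed.

Let Phi_le i j : antitone i -> antitone j ->
  (label_set (Phi i) \subset label_set (Phi j)) = (Phi i <= Phi j).
Proof.
move=> ai aj; apply/idP/idP => [sub|]; last exact: label_set_mono.
by rewrite -(Phi_min ai aj sub); apply: Phi_mono => c _; apply: geq_minr.
Qed.

Let Phi_const m : label_set (Phi (fun=> m)) = [set a : 'I_n | (a < m)%N].
Proof.
apply/setP => a; rewrite in_Phi in_set; apply/hasP/idP => [[c _ /andP[]]|am] //.
by exists \top; rewrite // label_setT in_setT.
Qed.

Let Phi_cut i j m : antitone i -> antitone j -> Phi i <= Phi j ->
  exists2 l, antitone l & cut m (Phi i) (Phi j) = Phi l.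
Proof.
(* Replacing [i] by [i'] turns the inequality of sweeps into a pointwise one of cutoffs. *)
move=> ai aj ij; pose i' c := minn (i c) (j c).
have ai' : antitone i' := antitone_min ai aj.
have <- : Phi i' = Phi i by apply: (Phi_min ai aj (label_set_mono ij)).
(* Cutoff version of [label_set_cut]: union becomes maximum, and restriction to labels below [m]
   becomes minimum with [m]. *)
pose l' c := minn (j c) m; pose l c := maxn (i' c) (l' c).
have al' : antitone l' := antitone_min aj (@antitone_const m).
exists l; first exact: antitone_max.
apply/esym/cut_label_set.
- by apply: Phi_mono => c _; apply: leq_maxl.
- by apply: Phi_mono => c _; rewrite geq_max geq_minr geq_minl.
rewrite label_set_Phi_max (label_set_Phi_min aj (@antitone_const m)).
by congr (_ :|: _); apply/setP => a; rewrite in_setI Phi_const !in_set.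
Qed.

Let Phi_bounded i : antitone i ->
  Phi i = Phi (fun c => minn (i c) n).
Proof.
clearbody Phi; move=> ai; apply/esym/(Phi_min ai (@antitone_const n)).
by rewrite Phi_const; apply/subsetP => a _; rewrite in_set.
Qed.

Let Phi_mem c : c \in s -> exists2 i, antitone i & c = Phi i.
Proof.
(* Cutoff [n] moves the sweep up to [c]; cutoff [0] then keeps it there. *)
move=> cs; pose i b := if b <= c then n else 0%N; exists i.
  move=> b b' _ _ bb'; rewrite /i; case: ifP => // b'c.
  by rewrite (le_trans bb' b'c).
have cut0 b u : u <= b -> cut 0 u b = u by move=> ub; rewrite cut_hi // hi0.
have cutn b u : u <= b -> cut n u b = b by move=> ub; rewrite cut_lo // lo_n.
have stay t u : path <=%O u t -> {in t, forall b, b <= c -> b <= u} ->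
  sweep i u t = u.
  elim: t => //= b t IH /andP[ub bt] le_u.
  have -> : cut (i b) u b = u.
    rewrite /i; case: ifP => [bc|_]; last exact: cut0.
    by rewrite cutn //; apply/le_anti; rewrite ub le_u ?mem_head.
  apply: IH; first exact: (path_le le_trans ub bt).
  by move=> b' b't; apply: le_u; rewrite in_cons b't orbT.
have := path_s; have := sub_sorted ltW s_sorted; rewrite /Phi.
case/splitPr: cs => s1 s2 ss;
  rewrite /sweep foldl_cat cat_path /= => /and3P[ps1 lc cs2].
have s1c := le_trans (sweep_le i ps1) lc.
have ic : i c = n by rewrite /i lexx.
by rewrite -/(sweep i \bot s1) ic cutn // -/(sweep i c s2) stay.
Qed.

(** Finite functions suffice because [Phi_bounded] truncates cutoffs at [n]. *)
Let sweeps : {set P} :=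
  [set Phi (fun b => f b) | f : {ffun P -> 'I_n.+1} in
    [set f : {ffun P -> 'I_n.+1} |
      [forall b in s, forall c in s, (b <= c) ==> (f c <= f b)%N]]].

Let sweepsP u : reflect (exists2 i, antitone i & u = Phi i) (u \in sweeps).
Proof.
apply: (iffP imsetP) => [[f]|[i ai ->]].
  rewrite inE => /forall_inP af ->.
  exists (fun b => f b : nat) => // b c bs cs bc.
  by have /forall_inP/(_ c cs) := af b bs; rewrite bc.
exists [ffun c => inord (minn (i c) n) : 'I_n.+1].
  rewrite inE; apply/forall_inP => b bs; apply/forall_inP => c cs;
    apply/implyP => bc.
  rewrite !ffunE !inordK ?ltnS ?geq_minr //.
  exact: antitone_min ai (@antitone_const n) b c bs cs bc.
have E c : [ffun c => inord (minn (i c) n) : 'I_n.+1] c = minn (i c) n :> nat.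
  by rewrite ffunE inordK // ltnS geq_minr.
by rewrite Phi_bounded //; apply/le_anti; rewrite !Phi_mono // => c _;
  rewrite E.
Qed.

Variables M c : {set P}.
Hypothesis M_xs : forall x, x \in M <-> exists m, x = xs m.
Hypothesis s_c : s =i \top |: c.

Let top_sweeps : \top \in sweeps.
Proof. by have [i ai ->] := Phi_mem top_s; apply/sweepsP; exists i. Qed.

Let bot_sweeps : \bot \in sweeps.
Proof.
apply/sweepsP; exists (fun=> 0); first exact: antitone_const.
apply: label_set_inj; first exact: le0x.
by apply/subsetP => a; rewrite Phi_const in_set.
Qed.

Let cut_sweeps m y z : y \in sweeps -> z \in sweeps -> y <= z ->
  cut m y z \in sweeps.
Proof.
move=> /sweepsP[i ai ->] /sweepsP[j aj ->] ij.
by have [l al ->] := Phi_cut m ai aj ij; apply/sweepsP; exists l.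
Qed.

Let sweeps_closed : R_closed M c sweeps.
Proof.
apply/and3P; split.
- apply/subsetP => _ /M_xs[m ->].
  suff <- : cut m \bot \top = xs m by apply: cut_sweeps (le0x _).
  apply/esym/cut_uniq; rewrite /split_at le0x lex1 /=; apply/andP; split.
    by apply/loP.
  by apply/hiP.
- apply/subsetP => b bc; have bs : b \in s by rewrite s_c in_setU1 bc orbT.
  by have [i ai ->] := Phi_mem bs; apply/sweepsP; exists i.
apply/forall_inP => _ /M_xs[m ->]; apply/forall_inP => y yR.
apply/forall_inP => z zR; apply/implyP => yz.
by have [-> ->] := cut_Some m yz; rewrite /= cut_sweeps.
Qed.

(** The sweeps form a closed set. Conversely, each is reached from [\bot] by cuts under elements of
    [\top |: c], and every closed set admits these. *)
Lemma R_gen_sweeps : R_gen M c = sweeps.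
Proof.
apply/eqP; rewrite eqEsubset; apply/andP; split; first exact: bigcap_inf.
apply/bigcapsP => R /and3P[/subsetP MR /subsetP cR /forall_inP closed].
have xsR m : xs m \in M by apply/M_xs; exists m.
have sR : {in s, forall b, b \in R}.
  move=> b; rewrite s_c => /setU1P[->|/cR//].
  by rewrite -xsn; apply/MR.
apply/subsetP => _ /sweepsP[i _ ->]; rewrite /Phi.
have : (\bot : P) \in R by rewrite -xs0; apply/MR.
elim: s \bot path_s sR => //= b t IH u /andP[ub bt] tR uR.
have bR : b \in R by rewrite tR ?mem_head.
apply: IH; first exact: (path_le le_trans (cut_le _ ub) bt).
  by move=> a at_; rewrite tR // in_cons at_ orbT.
have /forall_inP/(_ u uR)/forall_inP/(_ b bR) := closed _ (xsR (i b)).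
by have [-> _] := cut_Some (i b) ub; rewrite ub /= => /andP[].
Qed.

Lemma R_gen_distributive : distributive_lattice (R_gen M c).
Proof.
rewrite R_gen_sweeps; apply: (@ring_of_sets_distributive _ _ _ label_set).
- by move=> _ _ /sweepsP[i ai ->] /sweepsP[j aj ->]; apply: Phi_le.
- move=> _ _ /sweepsP[i ai ->] /sweepsP[j aj ->].
  exists (Phi (fun b => minn (i b) (j b))); last exact: label_set_Phi_min.
  by apply/sweepsP; eexists; [apply: antitone_min ai aj|].
move=> _ _ /sweepsP[i ai ->] /sweepsP[j aj ->].
exists (Phi (fun b => maxn (i b) (j b))); last exact: label_set_Phi_max.
by apply/sweepsP; eexists; [apply: antitone_max ai aj|].
Qed.

End Sweep.

End LeftModularChain.

(** * The equivalences *)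

Section Equivalences.
Context {d : Order.disp_t} {P : finTBPOrderType d}.
Implicit Types (M c : {set P}) (x y z : P).

Lemma graded_size_unrefinable n s : graded P n ->
  unrefinable (\bot : P) \top s -> size s = n.
Proof.
move=> gP us; have := gP _ (unrefinable_maximal_chain us).
rewrite cardsE (card_uniqP _) => [[]//|].
by apply: (sorted_uniq lt_trans ltxx); apply: (unrefinable_sorted us).
Qed.

Lemma maximal_chain_nth n M : graded P n -> maximal_chain M ->
  exists xs : nat -> P,
  [/\ xs 0 = \bot /\ xs n = \top,
      {homo xs : i j / (i <= j)%N >-> i <= j},
      forall i, (i < n)%N -> xs i < xs i.+1,
      forall i u, xs i <= u -> u <= xs i.+1 -> u = xs i \/ u = xs i.+1
    & forall x, x \in M <-> exists m, x = xs m].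
Proof.
move=> gP maxM; have [w [sw EM]] : exists w : seq P, sorted <%O w /\ M =
  [set x in w].
  by apply: sort_chain; case/maxsetP: maxM.
rewrite EM in maxM *; have [s Ew us] := maximal_chain_unrefinable sw maxM.
have sz := graded_size_unrefinable gP us; rewrite Ew in sw *.
have covs i : (i < n)%N ->
  covers (nth \top (\bot :: s) i) (nth \top (\bot :: s) i.+1).
  by case/andP: us => /(pathP \top) + _; rewrite sz; apply.
have topE i : (n <= i)%N -> nth \top (\bot :: s) i = \top.
  rewrite leq_eqVlt => /predU1P[<-|ni]; last by rewrite nth_default //= sz.
  rewrite -sz -[size s]/(size (\bot :: s)).-1 nth_last /=.
  exact: unrefinable_last us.
(* The default [\top] makes the sequence constant from [n] on. *)
exists (nth \top (\bot :: s)); split.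
- by split=> //; apply: topE.
- move=> i j ij; have [nj|jn] := leqP n j; first by rewrite (topE j) ?lex1.
  rewrite (sorted_leq_nth le_trans lexx) ?(sub_sorted ltW sw) // inE /= sz ltnS
    ltnW //.
  exact: leq_ltn_trans ij jn.
- by move=> i /covs/cover_lt.
- move=> i u; have [ni|/covs] := leqP n i; last exact: cover_between.
  by rewrite topE // => topu _; left; apply/le_anti; rewrite lex1.
move=> x; rewrite inE; split=> [xs|[m ->]].
  by exists (index x (\bot :: s)); rewrite nth_index.
have [nm|mn] := leqP n m; last by apply: mem_nth; rewrite /= sz ltnW.
by rewrite topE // -(unrefinable_last us) mem_last.
Qed.

Lemma left_modular_Sn_EL n : graded P n -> left_modular P ->
  has_Sn_EL_labelling P n.
Proof.
move=> gP [M maxM lmM].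
have [xs [[xs0 xsn] mono lt_xs cov inM]] := maximal_chain_nth gP maxM.
exists (label n xs); apply: label_Sn_EL => // [m|s];
  last exact: graded_size_unrefinable.
by apply: lmM; apply/inM; exists m.
Qed.

Lemma left_modular_supersolvable n : graded P n -> left_modular P ->
  supersolvable P.
Proof.
move=> gP [M maxM lmM]; exists M; split=> // [x /lmM[]//|c cc].
have [xs [[xs0 xsn] mono lt_xs cov inM]] := maximal_chain_nth gP maxM.
(* Adjoining [\top], an element of [M], does not change the generated subposet. *)
have [s [ss Es]] : exists s : seq P, sorted <%O s /\ \top |: c = [set x in s].
  apply: sort_chain; apply/chainP => u v /setU1P[->|uc] /setU1P[->|vc].
  - exact: comparablexx.
  - by rewrite /Order.comparable lex1 orbT.
  - by rewrite /Order.comparable lex1.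
  - exact: (chainP _ cc).
have sE : s =i \top |: c by move=> x; rewrite Es inE.
apply: (@R_gen_distributive _ _ n xs _ _ _ _ _ _ _ s) => //.
- by move=> m; apply: lmM; apply/inM; exists m.
- by move=> t; apply: graded_size_unrefinable.
by rewrite sE setU11.
Qed.

(** The elements demanded by [R_closed] are computed in [P], independently of [R], so closedness
    survives intersection. *)
Lemma R_gen_closed M c : R_closed M c (R_gen M c).
Proof.
apply/and3P; split; try by apply/bigcapsP => R /and3P[].
apply/forall_inP => x xM; apply/forall_inP => y /bigcapP yR.
apply/forall_inP => z /bigcapP zR; apply/implyP => yz.
have cl R : R_closed M c R ->
    oapp (mem R) true (join_meet x y z) && oapp (mem R) true (meet_join x y z).
  move=> /[dup] clR /and3P[_ _ /forall_inP/(_ x xM)/forall_inP/(_ y (yR R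
    clR))].
  by move=> /forall_inP/(_ z (zR R clR))/implyP; apply.
apply/andP; split.
  by case E: (join_meet x y z) => [u|] //=; apply/bigcapP => R /cl/andP[];
    rewrite E.
by case E: (meet_join x y z) => [u|] //=; apply/bigcapP => R /cl/andP[];
  rewrite E.
Qed.

(* Taking [c = {y, z}], the modular identity for [x], [y], [z] is an instance of
   distributivity in [R_gen M c]; the joins and meets involved agree with those
   of [P] since [\bot] and [\top] belong to [M]. *)
Lemma supersolvable_left_modular : supersolvable P -> left_modular P.
Proof.
move=> [M [maxM vM dM]]; exists M => // x xM; split=> [|y z yz];
  first exact: vM.
have cyz : chain [set y; z].
  apply/chainP => u v /set2P[]-> /set2P[]->; rewrite ?comparablexx //.
    by rewrite /Order.comparable yz.
  by rewrite /Order.comparable yz orbT.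
set R := R_gen M [set y; z].
have [lat dist] : distributive_lattice R := dM _ cyz.
have /and3P[/subsetP MR /subsetP cR /forall_inP/(_ x xM)/forall_inP clR] :=
  R_gen_closed M [set y; z].
have yR : y \in R by apply: cR; rewrite set21.
have zR : z \in R by apply: cR; rewrite set22.
have xR : x \in R := MR _ xM.
have botR : \bot \in R.
  by apply/MR/(maximal_chain_mem maxM) => v _; rewrite /Order.comparable le0x.
have topR : \top \in R.
  by apply/MR/(maximal_chain_mem maxM) => v _;
    rewrite /Order.comparable lex1 orbT.
have cl u v : u \in R -> v \in R -> u <= v -> exists a b,
    [/\ join_meet x u v = Some a, meet_join x u v = Some b, a \in R & b \in R].
  move=> uR vR uv; have [] := vM _ xM _ _ uv.
  have /forall_inP/(_ v vR)/implyP/(_ uv) := clR u uR.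
  case: (join_meet x u v) => [a|] //; case: (meet_join x u v) => [b|] //=.
  by move=> /andP[aR bR] _ _; exists a, b.
have [j [_ [/join_meet_Some[j' /join_in_Some[_ xj yj jP] [_ jj' _ jmax]] _ jR
  _]]] :=
  cl y \top yR topR (lex1 y).
have {j' xj yj jP jj' jmax} [xj yj jP] :
    [/\ x <= j, y <= j & forall v, x <= v -> y <= v -> j <= v].
  have -> : j = j' by apply/le_anti; rewrite jj' jmax ?lex1.
  by split=> // v; apply: jP; rewrite inE.
have [_ [m [_ /meet_join_Some[m' /meet_in_Some[_ mx mz mP] [m'm _ _ mmin]] _
  mR]]] :=
  cl \bot z botR zR (le0x z).
have {m' mx mz mP m'm mmin} [mx mz mP] :
    [/\ m <= x, m <= z & forall v, v <= x -> v <= z -> v <= m].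
  have -> : m = m' by apply/le_anti; rewrite m'm mmin ?le0x.
  by split=> // v; apply: mP; rewrite inE.
have joinR : join_in R x y = Some j.
  by apply/join_in_Some; split=> // v _; apply: jP.
have meetR : meet_in R z x = Some m.
  by apply/meet_in_Some; split=> // v _ vz vx; apply: mP.
have meetR' : meet_in R z y = Some y by apply/meet_in_Some; split.
(* This is [z /\ (x \/ y) = (z /\ x) \/ y] in [R], as [z /\ y = y]. *)
have := dist _ _ _ zR xR yR _ _ _ joinR meetR meetR'.
have [a [b [Ea Eb aR bR]]] := cl y z yR zR yz; rewrite Ea Eb.
move/join_meet_Some: Ea => [j' /join_in_Some[_ xj' yj' j'P] [ya aj' az amax]].
move/meet_join_Some: Eb => [m' /meet_in_Some[_ m'x m'z m'P] [m'b yb bz bmin]].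
have Ej : j' = j by apply/le_anti; rewrite jP // j'P.
have Em : m' = m by apply/le_anti; rewrite mP // m'P.
rewrite Ej in aj' amax; rewrite Em in m'b bmin.
have [+ _] := lat z j zR jR; case Ea: (meet_in R z j) => [a'|] // _.
have [_ +] := lat m y mR yR; case Eb: (join_in R m y) => [b'|] // _.
move/meet_in_Some: Ea => [a'R a'z a'j a'P].
move/join_in_Some: Eb => [b'R mb' yb' b'P] [Eab].
(* [a] is greatest among elements of [P] above [y], [a'] among those of [R]; each is a candidate for
   the other. *)
have -> : a = a' by apply/le_anti; rewrite a'P //= amax // a'P.
by rewrite Eab; congr Some; apply/le_anti; rewrite b'P //= bmin // b'P.
Qed.

End Equivalences.

Theorem theorem4 (d : Order.disp_t) (P : finTBPOrderType d) (n : nat)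
    (hP : graded P n) :
  [<-> has_Sn_EL_labelling P n; left_modular P; supersolvable P].
Proof.
tfae.
- exact: Sn_EL_left_modular.
- exact: left_modular_supersolvable hP.
- by move=> /supersolvable_left_modular; apply: (left_modular_Sn_EL hP).
Qed.
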